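(* Let $H$ be a separable infinite-dimensional complex Hilbert space, $J$ a conjugation in $H$, and $\mathcal F=\{f_k\}_{k\in\mathbb{Z}_+}$ an orthonormal basis in $H$ corresponding to $J$. Let $A$ be a linear operator in $H$ which is J-symmetric (respectively, J-skew-symmetric) and such that $\mathcal F\subset D(A)$. Let $a_{i,j}=(Af_j,f_i)$, $i,j\in\mathbb{Z}_+$, be the entries of the matrix of $A$ in the basis $\mathcal F$. Then for every $g=\sum_{k=0}^\infty g_kf_k\in D(A)$, $$Ag=\sum_{i=0}^\infty y_if_i,\qquad y_i=\sum_{k=0}^\infty a_{i,k}g_k .$$
   Context: $\mathbb{Z}_+$ is the set of non-negative integers. Linear operators $A$ in $H$ are possibly unbounded, defined on a linear subspace $D(A)\subseteq H$. The scalar product $(\cdot,\cdot)$ is linear in the first argument. A conjugation in $H$ is a map $J:H\to H$ with $J^2=E$ (the identity) and $(Jx,Jy)=\overline{(x,y)}$ for all $x,y\in H$. An orthonormal basis $\{f_k\}_{k\in\mathbb{Z}_+}$ of $H$ corresponds to $J$ if $Jx=\sum_{k}\overline{x_k}f_k$ for every $x=\sum_kx_kf_k\in H$. The J-form is $[x,y]_J:=(x,Jy)$. A linear operator $A$ is J-symmetric if $[Ax,y]_J=[x,Ay]_J$ for all $x,y\in D(A)$, and J-skew-symmetric if $[Ax,y]_J=-[x,Ay]_J$ for all $x,y\in D(A)$. *)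

(* Defs.v *)
From mathcomp Require Export all_boot all_order all_algebra.
From mathcomp Require Export all_classical all_reals all_analysis.
From mathcomp Require Export complex.

Set Implicit Arguments.
Unset Strict Implicit.
Unset Printing Implicit Defensive.

Export Order.TTheory GRing.Theory Num.Theory.
Export numFieldNormedType.Exports.

Open Scope classical_set_scope.
Open Scope ring_scope.
Open Scope complex_scope.

Definition sums_to (K : numFieldType) (V : normedModType K)
    (u : nat -> V) (x : V) : Prop :=
  series u @ \oo --> x.

Definition separable_space (T : topologicalType) : Prop :=
  exists S : set T, countable S /\ dense S.

Definition linear_span (K : numFieldType) (V : lmodType K) (S : set V) : set V :=
  [set x | exists (n : nat) (c : 'I_n -> K) (v : 'I_n -> V),
     (forall i, S (v i)) /\ x = \sum_(i < n) c i *: v i].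

Definition infinite_dimensional (K : numFieldType) (V : lmodType K) : Prop :=
  forall S : set V, finite_set S -> linear_span S <> setT.

Section Hilbert.
Context (R : realType) (H : completeNormedModType R[i]).

(* {dot H for conj} is a positive definite Hermitian form, linear in its first
   argument. A complex Hilbert space is a complete normed space whose norm is
   induced by such a form; `|x| is the R[i]-valued norm, a nonnegative real. *)
Definition induces_norm (dot : {dot H for (@Num.conj R[i])}) : Prop :=
  forall x : H, `|x| ^+ 2 = dot x x.

Context (dot : {dot H for (@Num.conj R[i])}).

Definition orthonormal_seq (f : nat -> H) : Prop :=
  forall i j : nat, dot (f i) (f j) = (i == j)%:R.

Definition orthonormal_basis (f : nat -> H) : Prop :=
  orthonormal_seq f /\ dense (linear_span (range f)).

Definition conjugation (J : H -> H) : Prop :=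
  (forall x, J (J x) = x) /\ (forall x y, dot (J x) (J y) = (dot x y)^*%R).

Definition corresponds_to (f : nat -> H) (J : H -> H) : Prop :=
  forall (x : H) (c : nat -> R[i]),
    sums_to (fun k => c k *: f k) x -> sums_to (fun k => (c k)^*%R *: f k) (J x).

(* The map is total, but its values outside of the domain are unspecified and
   never referred to. *)
Record operator := Operator {
  dom : set H;
  op_fun :> H -> H;
  dom0 : dom 0;
  domD : forall x y, dom x -> dom y -> dom (x + y);
  domZ : forall (a : R[i]) x, dom x -> dom (a *: x);
  opD : forall x y, dom x -> dom y -> op_fun (x + y) = op_fun x + op_fun y;
  opZ : forall (a : R[i]) x, dom x -> op_fun (a *: x) = a *: op_fun x
}.

Definition J_form (J : H -> H) (x y : H) : R[i] := dot x (J y).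

Definition J_symmetric (J : H -> H) (A : operator) : Prop :=
  forall x y, dom A x -> dom A y -> J_form J (A x) y = J_form J x (A y).

Definition J_skew_symmetric (J : H -> H) (A : operator) : Prop :=
  forall x y, dom A x -> dom A y -> J_form J (A x) y = - J_form J x (A y).

Definition matrix_entry (A : operator) (f : nat -> H) (i j : nat) : R[i] :=
  dot (A (f j)) (f i).

End Hilbert.

(* Main.v *)
Require Import Defs.

Set Implicit Arguments.
Unset Strict Implicit.
Unset Printing Implicit Defensive.

(** The coordinates of [A g] in an orthonormal basis are
    [dot (A g) (f i)], so the content of the theorem is that these numbers are
    given by the matrix series. Expanding g and moving the sum outside of
    [dot (A _) (f i)] would do it if A were bounded. For unbounded A, what saves
    the argument is that the functional [x |-> dot (A x) (f i)] is nevertheless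
    bounded on the domain of A: since J fixes the basis vectors,
      (A x, f_i) = [A x, f_i]_J = ± [x, A f_i]_J = (x, ± J (A f_i)),
    so that f_i belongs to the domain of the adjoint of A
    ([symmetric_adjoint_at_real]). Hence (A g, f_i) = (g, b_i) for a fixed
    vector b_i, the scalar product can be taken term by term in the expansion of
    g ([dot_sums_to]), and (c_k f_k, b_i) = c_k (A f_k, f_i) = a_(i,k) c_k. The two
    symmetry types differ only in the sign of b_i.

    The Hilbert space facts behind this are Cauchy-Schwarz, which gives the
    continuity of [dot], and the convergence of orthogonal expansions
    ([basis_expansion]). Both come down to the same consequence of Pythagoras'
    theorem, [norm_le_orthogonal_add]. *)

Section InnerProduct.
Context (R : realType) (H : completeNormedModType R[i]).
Context (dot : {dot H for (@Num.conj R[i])}).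
Hypothesis dot_norm : induces_norm dot.

Lemma norm_le_orthogonal_add (u v : H) : dot u v = 0 -> `|v| <= `|u + v|.
Proof.
move=> uv0; rewrite -ler_sqr ?nnegrE ?normr_ge0// !dot_norm.
by rewrite (hnormDd uv0) lerDr; exact: dnorm_ge0.
Qed.

(** The component of x along y has norm [|dot x y| / |y|], and it is at most [|x|]
    because the remainder of x is orthogonal to it. *)
Lemma norm_dot_le (x y : H) : `|dot x y| <= `|x| * `|y|.
Proof.
have [->|y0] := eqVneq y 0; first by rewrite linear0r !normr0 mulr0.
have q0 : 0 < `|y| by rewrite normr_gt0.
set a := dot x y / `|y| ^+ 2.
have orth : dot (x - a *: y) (a *: y) = 0.
  rewrite linearZr_LR /= linearBl linearZl_LR /= -dot_norm /a.
  by rewrite divfK ?subrr ?mulr0// expf_neq0// gt_eqF.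
have := norm_le_orthogonal_add orth.
rewrite subrK normrZ normrM normfV normrX normr_id expr2 invfM mulrA.
by rewrite divfK ?gt_eqF// ler_pdivrMr.
Qed.

(** By Cauchy-Schwarz, [dot _ z] is Lipschitz and so commutes with infinite sums. *)
Lemma dot_sums_to (u : nat -> H) (x z : H) :
  sums_to u x -> sums_to (fun k => dot (u k) z : R[i]^o) (dot x z).
Proof.
rewrite /sums_to => /cvgrPdist_lt ux; apply/cvgrPdist_lt => e e0.
(* The added 1 keeps the Lipschitz constant positive when z = 0. *)
have z0 : 0 < `|z| + 1 by rewrite ltr_wpDl.
near=> n.
have -> : series (fun k => dot (u k) z : R[i]^o) n = dot (series u n) z.
  by rewrite /series/= linear_sumlz.
rewrite -linearBl; apply: le_lt_trans (norm_dot_le _ _) _.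
apply: (@le_lt_trans _ _ (`|x - series u n| * (`|z| + 1))).
  by rewrite ler_wpM2l// lerDl.
rewrite -ltr_pdivlMr//; near: n.
by apply: ux; rewrite divr_gt0.
Unshelve. all: by end_near. Qed.

(** The functional [x |-> dot (A x) v] on the domain of A is bounded, although A
    need not be: for J-real v it is the J-form against v, and the symmetry moves
    A from x to the fixed vector v. *)
Lemma symmetric_adjoint_at_real (J : H -> H) (A : operator H) (v : H) :
  J_symmetric dot J A \/ J_skew_symmetric dot J A ->
  dom A v -> J v = v ->
  exists b : H, forall x, dom A x -> dot (A x) v = dot x b.
Proof.
move=> symA vA Jv.
case: symA => symA; [exists (J (A v)) | exists (- J (A v))] => x xA.
  by rewrite -{1}Jv; exact: symA.
by rewrite linearNr -{1}Jv; exact: symA.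
Qed.

Section Basis.
Context (f : nat -> H).
Hypothesis basisf : orthonormal_basis dot f.

Let proj (x : H) := series (fun k => dot x (f k) *: f k).

Lemma partial_sum_residue_orthogonal (x : H) (n j : nat) :
  (j < n)%N -> dot (x - proj x n) (f j) = 0.
Proof.
move=> jn; rewrite linearBl /proj /series /= linear_sumlz.
rewrite (bigD1_seq j) ?mem_index_iota ?iota_uniq//=.
rewrite big1 ?addr0 => [|k kj]; last first.
  by rewrite linearZl_LR /= basisf.1 (negPf kj) mulr0.
by rewrite linearZl_LR /= basisf.1 eqxx mulr1 subrr.
Qed.

(** The n-th partial sum is the orthogonal projection of x on the span of
    [f 0, ..., f n.-1], and is therefore the best approximation of x there: the
    residue is orthogonal to the difference of any two vectors of this span. *)
Lemma partial_sum_residue_le (x : H) (n m : nat) (c : 'I_m -> R[i])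
    (k : 'I_m -> nat) :
  (forall i, (k i < n)%N) ->
  `|x - proj x n| <= `|x - \sum_(i < m) c i *: f (k i)|.
Proof.
move=> kn; set v := \sum_(i < m) _.
have orth : dot (proj x n - v) (x - proj x n) = 0.
  apply/eqP; rewrite herm_eq0C linearBr subr_eq0; apply/eqP.
  rewrite {2}/proj /series /= /v !linear_sumr.
  rewrite big_nat big1 => [|j /andP[_ jn]]; last first.
    by rewrite linearZr_LR /= partial_sum_residue_orthogonal ?mulr0.
  rewrite big1// => i _.
  by rewrite linearZr_LR /= partial_sum_residue_orthogonal ?mulr0.
by have := norm_le_orthogonal_add orth; rewrite [X in _ <= `|X|]addrC addrA subrK.
Qed.

(** Density gives a finite combination of basis vectors close to x; once n exceeds
    all the indices that occur in it, the n-th partial sum is at least as close. *)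
Lemma basis_expansion (x : H) : sums_to (fun k => dot x (f k) *: f k) x.
Proof.
rewrite /sums_to; apply/cvgrPdist_lt => e e0.
have [|v [xv [m [c [w [fw vE]]]]]] := basisf.2 (ball x e) _ (ball_open x e).
  by exists x; exact: ballxx.
have {}fw i : exists j, f j = w i by have [j _ fj] := fw i; exists j.
have [k kE] := choice fw.
exists (\max_(i < m) k i).+1 => //= n mn.
have kn i : (k i < n)%N by rewrite (leq_trans _ mn)// ltnS leq_bigmax.
apply: le_lt_trans (partial_sum_residue_le x c kn) _.
under eq_bigr do rewrite kE.
by rewrite -vE; move: xv; rewrite -ball_normE.
Qed.

(** The coordinates of [f i] are 0 and 1, hence real. *)
Lemma corresponding_conjugation_fixes_basis (J : H -> H) (i : nat) :
  corresponds_to f J -> J (f i) = f i.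
Proof.
move=> fJ; have fi := @basis_expansion (f i).
have := fJ _ _ fi.
have -> : (fun k => (dot (f i) (f k))^*%R *: f k) =
          (fun k => dot (f i) (f k) *: f k).
  by apply/funext => k; rewrite basisf.1 conjC_nat.
by move=> Ji; exact: cvg_unique Ji fi.
Qed.

End Basis.
End InnerProduct.

Theorem theorem3p1 (R : realType) (H : completeNormedModType R[i])
    (dot : {dot H for (@Num.conj R[i])})
    (dot_norm : induces_norm dot)
    (sepH : separable_space H)
    (infH : infinite_dimensional H)
    (J : H -> H) (conjJ : conjugation dot J)
    (f : nat -> H) (basisf : orthonormal_basis dot f)
    (fJ : corresponds_to f J)
    (A : operator H)
    (symA : J_symmetric dot J A \/ J_skew_symmetric dot J A)
    (fA : forall k, dom A (f k)) :
  forall (g : H) (c : nat -> R[i]),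
    dom A g -> sums_to (fun k => c k *: f k) g ->
    exists y : nat -> R[i],
      (forall i, sums_to (fun k => matrix_entry dot A f i k * c k : R[i]^o) (y i))
      /\ sums_to (fun i => y i *: f i) (A g).
Proof.
move=> g c gA gE; exists (fun i => dot (A g) (f i)).
split; last exact: (basis_expansion dot_norm basisf).
have Jf i : J (f i) = f i.
  exact: (corresponding_conjugation_fixes_basis dot_norm basisf).
move=> i; have [b bE] := symmetric_adjoint_at_real symA (fA i) (Jf i).
rewrite bE//.
have -> : (fun k => matrix_entry dot A f i k * c k : R[i]^o) =
    (fun k => dot (c k *: f k) b : R[i]^o).
  by apply/funext => k; rewrite /matrix_entry linearZl_LR /= bE// mulrC.
exact: dot_sums_to.
Qed.
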